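(* Every stacked component $\mathcal{T}$ (the graph specified in the context) satisfies $\mathrm{diam}(\mathcal{T})=\frac12(\mathrm{ord}(\ell)+3)$.
   Context: Let $p$ be a prime with $p\equiv 71$ or $119\pmod{120}$, let $\ell=2$, and let $\mathrm{ord}(\ell)$ be the order, in the ideal class group of $\mathbb{Q}(\sqrt{-p})$, of a prime ideal above $2$; it is an odd integer $\ge 3$. A stacked component $\mathcal{T}$ (a component of the supersingular $2$-isogeny graph over $\mathbb{F}_p$ after identifying curves up to $\overline{\mathbb{F}_p}$-isomorphism, regarded as a simple undirected graph) is, writing $L=\mathrm{ord}(\ell)$, labelled so that $V(\mathcal{T})=\{0,1,\dots,2L-1\}$ and $$E(\mathcal{T})=\{\{2i,2i+1\}:0\le i\le L-1\}\cup\{\{2i+1,2i+3\}:0\le i\le L-2\}\cup\{\{2L-1,1\}\}.$$ The diameter is the maximum graph distance between two vertices. *)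

(* Defs.v *)
(* MathComp, with the classical sets of MathComp-Analysis for ideals. *)
From mathcomp Require Import all_boot all_order all_algebra all_field.
From mathcomp Require Import boolp classical_sets.

Set Implicit Arguments.
Unset Strict Implicit.
Unset Printing Implicit Defensive.

Import Order.TTheory GRing.Theory Num.Theory.

Section IdealClasses.
Local Open Scope ring_scope.
Local Open Scope classical_set_scope.

(* Q(sqrt(-p)), as a subfield of the algebraic numbers. *)
Definition imag_quad_field (p : nat) : set algC :=
  [set x | exists a b : rat, x = ratr a + ratr b * sqrtC (- p%:R)].

Definition imag_quad_ring (p : nat) : set algC :=
  [set x | imag_quad_field p x /\ x \in Aint].

(* In the rest of the section, O is a set of algebraic numbers, used only when
   it is a subring of algC such as imag_quad_ring p. *)
Definition is_ideal (O I : set algC) : Prop :=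
  [/\ I `<=` O,
      I 0,
      forall x y, I x -> I y -> I (x + y) &
      forall a x, O a -> I x -> I (a * x)].

Definition is_prime_ideal (O P : set algC) : Prop :=
  [/\ is_ideal O P,
      ~ P 1 &
      forall x y, O x -> O y -> P (x * y) -> P x \/ P y].

(* Containing the image of l amounts to dividing l O. *)
Definition is_prime_ideal_above (O : set algC) (l : nat) (P : set algC) : Prop :=
  is_prime_ideal O P /\ P l%:R.

Definition ideal_mul (I J : set algC) : set algC :=
  [set z | exists (n : nat) (x y : 'I_n -> algC),
     (forall i, I (x i) /\ J (y i)) /\ z = \sum_(i < n) x i * y i].

Definition ideal_exp (O I : set algC) (n : nat) : set algC :=
  iter n (ideal_mul I) O.

(* Equality in the ideal class group, whose product is induced by ideal_mul and
   whose neutral element is the class of O. *)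
Definition same_ideal_class (O I J : set algC) : Prop :=
  exists a b : algC, [/\ O a, O b, a != 0, b != 0 &
    [set a * x | x in I] = [set b * y | y in J]].

Definition is_ideal_class_order (O P : set algC) (n : nat) : Prop :=
  [/\ (0 < n)%N,
      same_ideal_class O (ideal_exp O P n) O &
      forall m : nat, (0 < m < n)%N ->
        ~ same_ideal_class O (ideal_exp O P m) O].

End IdealClasses.

Section Diameter.
Variables (V : finType) (e : rel V).

Definition has_walk (x y : V) (k : nat) : bool :=
  [exists s : k.-tuple V, path e x s && (last x s == y)].

(* A shortest walk has fewer than #|V| edges, so the bounded search is
   exhaustive; #|V| itself is returned exactly when y is unreachable from x. *)
Definition graph_dist (x y : V) : nat := find (has_walk x y) (iota 0 #|V|).

(* Equal to #|V|, which is not the diameter of any connected graph on V, when e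
   is disconnected. *)
Definition diam : nat := \max_(x : V) \max_(y : V) graph_dist x y.

End Diameter.

Definition stacked_edges (L : nat) : seq (nat * nat) :=
  [seq (2 * i, 2 * i + 1) | i <- iota 0 L]
  ++ [seq (2 * i + 1, 2 * i + 3) | i <- iota 0 (L - 1)]
  ++ [:: (2 * L - 1, 1)].

Definition stacked_adj (L u v : nat) : bool :=
  ((u, v) \in stacked_edges L) || ((v, u) \in stacked_edges L).

(* The simple graph (V, e) admits the labelling of its vertices by
   0, ..., 2L - 1 that describes a stacked component. *)
Definition is_stacked_component (L : nat) (V : finType) (e : rel V) : Prop :=
  exists2 f : V -> 'I_(2 * L), bijective f &
    forall u v : V, e u v = stacked_adj L (f u) (f v).

(* Main.v *)
(* Let p = 8k + 7 and w = (1 + sqrt(-p)) / 2, so that the ring of integers is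
   Z + Z w. If P ^ L is principal, it is generated by some c = a + b w of norm
   2 ^ L whose conjugate lies outside P, and b is odd. For L = 2m the equation
   (2a + b) ^ 2 + p b ^ 2 = 2 ^ (L + 2) factors into coprime integers, which
   gives an element of norm 2 ^ m; it generates the ideal P ^ m or its
   conjugate, contradicting the minimality of L. Hence L is odd, and L = 1 is
   excluded by the size of p. In the graph, the odd labels form a cycle of odd
   length L and each even label is a pendant vertex attached to it, so two
   vertices at maximal distance are pendants over points of the cycle at
   distance (L - 1) / 2. *)
Require Import Defs.
From mathcomp Require Import all_boot all_order all_algebra all_field.
From mathcomp Require Import boolp classical_sets.
From mathcomp Require Import zify ring.
Set Implicit Arguments.
Unset Strict Implicit.
Unset Printing Implicit Defensive.
Import Order.TTheory GRing.Theory Num.Theory.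

(** * The order of a prime above 2 is odd *)

Local Open Scope ring_scope.

(** The square of [gcdn a c] is the gcd of a^2, a c and c^2 = a b, that is, a times gcd(a, c, b) =
    1. *)
Lemma coprime_mul_eq_sqr (a b c : nat) :
  coprime a b -> (a * b = c ^ 2)%N -> exists d, (a = d ^ 2)%N.
Proof.
move=> /eqP ab abc; exists (gcdn a c).
have g1 : gcdn (gcdn a c) (gcdn c b) = 1%N.
  apply/eqP; rewrite -dvdn1 -ab dvdn_gcd (dvdn_trans (dvdn_gcdl _ _)) ?dvdn_gcdl //.
  by rewrite (dvdn_trans (dvdn_gcdr _ _)) ?dvdn_gcdr.
by rewrite -mulnn muln_gcdl !muln_gcdr mulnn mulnn -abc (mulnC c a) -!muln_gcdr g1 muln1.
Qed.

(** * Ideals and their classes in a subring of the algebraic numbers *)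

Section Ideals.
Variable O : set algC.
Hypotheses (O0 : O 0) (O1 : O 1).
Hypothesis OD : forall x y, O x -> O y -> O (x + y).
Hypothesis OM : forall x y, O x -> O y -> O (x * y).

Lemma ideal_sum (I : set algC) (n : nat) (x : 'I_n -> algC) :
  is_ideal O I -> (forall i, I (x i)) -> I (\sum_(i < n) x i).
Proof. by case=> _ I0 ID _ Ix; elim/big_ind: _. Qed.

Lemma is_ideal_mul (I J : set algC) :
  is_ideal O I -> is_ideal O J -> is_ideal O (ideal_mul I J).
Proof.
move=> II IJ; have [IO I0 _ IM] := II; have [JO _ _ _] := IJ.
have OO : is_ideal O O by split.
split=> [_ [n [x [y [xy ->]]]]||_ _ [n [x [y [xy ->]]]] [m [z [t [zt ->]]]]
        |a _ Oa [n [x [y [xy ->]]]]].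
- apply: (ideal_sum OO) => i; have [? ?] := xy i.
  by apply: OM; [apply: IO|apply: JO].
- exists 0%N, (fun=> 0), (fun=> 0); split; last by rewrite big_ord0.
  by case.
- exists (n + m)%N, (fun i => match split i with inl j => x j | inr j => z j end),
    (fun i => match split i with inl j => y j | inr j => t j end); split.
    by move=> i; case: (split i).
  rewrite big_split_ord /=; congr (_ + _); apply: eq_bigr => i _.
    by rewrite (unsplitK (inl i)).
  by rewrite (unsplitK (inr i)).
- exists n, (fun i => a * x i), y; split.
    by move=> i; have [? ?] := xy i; split => //; apply: IM.
  by rewrite mulr_sumr; apply: eq_bigr => i _; rewrite mulrA.
Qed.

Lemma is_ideal_exp (I : set algC) (n : nat) :
  is_ideal O I -> is_ideal O (ideal_exp O I n).
Proof.
move=> II; elim: n => [|n IHn]; first by split.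
exact: is_ideal_mul.
Qed.

Lemma ideal_exp_expr (I : set algC) (x : algC) (n : nat) :
  I x -> ideal_exp O I n (x ^+ n).
Proof.
move=> Ix; elim: n => [|n IHn] //.
exists 1%N, (fun=> x), (fun=> x ^+ n); split; first by [].
by rewrite big_ord1 exprS.
Qed.

(** Modulo [x] every power of [1 - x] is 1. This carries comaximality with an ideal over to the
    powers of that ideal. *)
Lemma one_sub_exprP (x : algC) (n : nat) : O x -> O (- 1) ->
  exists2 u, O u & 1 - (1 - x) ^+ n = x * u.
Proof.
move=> Ox ON1; elim: n => [|n [u Ou xu]].
  by exists 0; rewrite // expr0 subrr mulr0.
exists (u + (1 - x) ^+ n).
  apply: OD => //; elim: n {xu} => [|n IHn]; rewrite ?expr0 // exprS.
  by apply: OM => //; apply: OD => //; rewrite -mulN1r; apply: OM.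
have -> : (1 - x) ^+ n = 1 - x * u by rewrite -xu; ring.
by rewrite exprS -[(1 - x) ^+ n](subKr 1) xu; ring.
Qed.

Lemma same_class_principal (I : set algC) (d : algC) :
  O d -> d != 0 -> (forall z, I z <-> exists2 t, O t & z = d * t) ->
  same_ideal_class O I O.
Proof.
move=> Od d0 Id; exists 1, d; split=> //; first exact: oner_neq0.
apply/seteqP; split=> z /=.
  by case=> _ /Id[t Ot ->] <-; exists t; rewrite // mul1r.
case=> t Ot <-; exists (d * t); last by rewrite mul1r.
by apply/Id; exists t.
Qed.

(** The generator is the quotient [b / a], a priori only an element of the field; it lies in [O] as
    soon as [I] does. *)
Lemma same_class_O_principal (I : set algC) :
  same_ideal_class O I O ->
  exists2 c, c != 0 & forall z, I z <-> exists2 t, O t & z = c * t.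
Proof.
case=> a [b [Oa Ob a0 b0 /seteqP[IO OI]]]; exists (b / a).
  by rewrite mulf_neq0 ?invr_eq0.
move=> z; split=> [Iz|[t Ot ->]].
  have [|t Ot bt] := IO (a * z); first by exists z.
  by exists t => //; apply: (mulfI a0); rewrite -bt; field.
have [|y Iy ay] := OI (b * t); first by exists t.
suff -> : b / a * t = y by [].
by apply: (mulfI a0); rewrite ay; field.
Qed.

End Ideals.

(** * The ring of integers Z + Z w, its conjugation and its norm form *)

Section ImaginaryQuadraticRing.
Variables p k : nat.
Hypotheses (p_prime : prime p) (pE : p = (8 * k + 7)%N).

Let s : algC := sqrtC (- p%:R).
Let w : algC := (1 + s) / 2%:R.
Let O := imag_quad_ring p.

Let pC : p%:R = 8%:R * k%:R + 7%:R :> algC.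
Proof. by rewrite pE natrD natrM. Qed.

Let s2 : s ^+ 2 = - p%:R.
Proof. exact: sqrtCK. Qed.

Let p0 : p%:R != 0 :> algC.
Proof. by rewrite pnatr_eq0 pE addn_eq0 andbF. Qed.

Let s0 : s != 0.
Proof. by rewrite sqrtC_eq0 oppr_eq0. Qed.

(** Multiplied by [s], both sides become p, since s times its conjugate is |s|^2 = |s^2|. *)
Let conj_s : s^* = - s.
Proof.
apply: (mulfI s0); rewrite -normCK -normrX s2 normrN normr_nat.
by rewrite mulrN -expr2 s2 opprK.
Qed.

Let sE : s = 2%:R * w - 1.
Proof. by rewrite /w; field. Qed.

(** The norm of [w] is (1 + p) / 4 = 2 (k + 1); it is even because p is 7 modulo 8, which is why 2
    splits. *)
Let w2 : w ^+ 2 = w - 2%:R * (k%:R + 1).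
Proof.
have -> : w ^+ 2 = (1 + 2%:R * s + s ^+ 2) / 4%:R by rewrite /w; field.
by rewrite s2 pC /w; field.
Qed.

Let conj_w : w^* = 1 - w.
Proof. by rewrite /w fmorph_div rmorphD rmorph1 rmorph_nat /= conj_s; field. Qed.

Let w_Aint : w \in Aint.
Proof.
apply: (@root_monic_Aint ('X^2 - 'X + (2 * k.+1)%:R%:P)).
- rewrite /root !hornerE w2 natrM -addn1 natrD.
  by apply/eqP; ring.
- by apply/monicP; rewrite -addrA lead_coefDl ?lead_coefXn // size_polyXn
     (leq_ltn_trans (size_polyD _ _)) // size_polyN size_polyX gtn_max size_polyC;
     case: eqP.
- apply/polyOverP => i; rewrite !coefE rpredD ?rpredB ?rpred_nat //.
  by case: ifP; rewrite ?rpred_nat ?rpred0.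
Qed.

Lemma imag_quad_ringP (x : algC) :
  O x <-> exists a b : int, x = a%:~R + b%:~R * w.
Proof.
split=> [[[r [t xE]] xA]|[a [b ->]]]; last first.
  split; last first.
    by apply: rpredD; [exact: Aint_int|apply: rpredM => //; exact: Aint_int].
  exists (a%:~R + b%:~R / 2%:R), (b%:~R / 2%:R); rewrite -/s /w.
  by rewrite !rmorphD !fmorph_div /= !ratr_int !ratr_nat; field.
rewrite -/s in xE.
have yA : x^* \in Aint by rewrite Aint_aut.
have yE : x^* = ratr r - ratr t * s.
  by rewrite xE rmorphD (rmorphM _ (ratr t)) /= !(conj_Crat (Crat_rat _)) conj_s mulrN.
have ratI (z : rat) : ratr z \in Aint -> exists m : int, z = m%:~R.
  move=> /(Cint_rat_Aint (Crat_rat z)) /intrP[m zm]; exists m.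
  by apply: (fmorph_inj (@ratr algC)); rewrite /= ratr_int.
have [u uE] : exists u : int, 2%:R * r = u%:~R.
  apply: ratI; rewrite rmorphM rmorph_nat /=.
  have -> : 2%:R * ratr r = x + x^* by rewrite xE in yE *; rewrite yE; ring.
  exact: rpredD.
have [n nE] : exists n : int, r ^+ 2 + p%:R * t ^+ 2 = n%:~R.
  apply: ratI; rewrite rmorphD rmorphM !rmorphXn rmorph_nat /=.
  have -> : ratr r ^+ 2 + p%:R * ratr t ^+ 2 = x * x^*.
    by rewrite yE xE -[p%:R]opprK -s2; ring.
  exact: rpredM.
have sA : s \in Aint by rewrite sE; apply/rpredB/rpred1/rpredM => //; apply: rpred_nat.
(* Trace and norm are integral; multiplying conj x - x by [s] gives a third rational integer, which
   bounds the denominator of [t] by 2 p. As p is prime and divides z^2, it divides z, and the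
   denominator is at most 2. *)
have [z zE] : exists z : int, 2%:R * p%:R * t = z%:~R.
  apply: ratI; rewrite !rmorphM !rmorph_nat /=.
  have -> : 2%:R * p%:R * ratr t = (x^* - x) * s.
    by rewrite yE xE -[p%:R]opprK -s2; ring.
  by apply: rpredM => //; exact: rpredB.
have zz : z ^+ 2 = p%:Z * (4%:Z * n - u ^+ 2).
  apply: (@intr_inj rat); rewrite !(rmorphXn, rmorphB, rmorphM) /= -zE -nE -uE.
  by rewrite -!pmulrn; ring.
have [v vE] : exists v, z = p%:Z * v.
  have : (p %| `|z ^+ 2|)%N by rewrite zz abszM dvdn_mulr.
  rewrite abszX Euclid_dvdX // andbT => pz.
  by have /dvdzP[v ->] : (p%:Z %| z)%Z by []; exists v; rewrite mulrC.
have tv : 2%:R * t = v%:~R.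
  have pq0 : p%:R != 0 :> rat by rewrite pnatr_eq0 pE addn_eq0 andbF.
  by apply: (mulfI pq0); rewrite mulrA (mulrC p%:R) zE vE rmorphM /= -pmulrn.
have uv : u ^+ 2 + p%:Z * v ^+ 2 = 4%:Z * n.
  apply: (@intr_inj rat); rewrite !(rmorphXn, rmorphD, rmorphM) /= -nE -uE -tv.
  by rewrite -!pmulrn; ring.
(* Since p is 3 modulo 4, u^2 + p v^2 is divisible by 4 only if u and v have the same parity. *)
have [a aE] : exists a, u = v + 2%:Z * a.
  have pZ : p%:Z = 8%:Z * k%:Z + 7%:Z by rewrite pE PoszD PoszM.
  move: uv; rewrite pZ.
  have par (m : int) : exists m', m = 2%:Z * m' \/ m = 2%:Z * m' + 1.
    by exists (m %/ 2)%Z; lia.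
  have [u' [->|->]] := par u; have [v' [->|->]] := par v => uv.
  - by exists (u' - v'); lia.
  - by exfalso; lia.
  - by exfalso; lia.
  - by exists (u' - v'); lia.
exists a, v; rewrite xE.
have ua : u%:~R = v%:~R + 2%:R * a%:~R :> rat by rewrite aE rmorphD rmorphM.
have -> : r = v%:~R / 2%:R + a%:~R.
  by apply: (mulfI (_ : 2%:R != 0)); rewrite ?uE ?ua //; field.
have -> : t = v%:~R / 2%:R by rewrite -tv; field.
by rewrite !rmorphD !fmorph_div /= !ratr_int !ratr_nat /w; field.
Qed.

Let O_int (m : int) : O m%:~R.
Proof. by apply/imag_quad_ringP; exists m, 0; rewrite mul0r addr0. Qed.

Let O0 : O 0. Proof. exact: (O_int 0). Qed.
Let O1 : O 1. Proof. exact: (O_int 1). Qed.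
Let ON1 : O (- 1). Proof. exact: (O_int (- 1)). Qed.

Let Ow : O w.
Proof. by apply/imag_quad_ringP; exists 0, 1; rewrite add0r mul1r. Qed.

Let OD (x y : algC) : O x -> O y -> O (x + y).
Proof.
move=> /imag_quad_ringP[a [b ->]] /imag_quad_ringP[c [d ->]].
by apply/imag_quad_ringP; exists (a + c), (b + d); rewrite !rmorphD /=; ring.
Qed.

Let OM (x y : algC) : O x -> O y -> O (x * y).
Proof.
move=> /imag_quad_ringP[a [b ->]] /imag_quad_ringP[c [d ->]].
apply/imag_quad_ringP.
exists (a * c - 2%:Z * (k%:Z + 1) * b * d), (a * d + b * c + b * d).
rewrite !(rmorphD, rmorphN, rmorphM) /= -!pmulrn.
transitivity (a%:~R * c%:~R + (a%:~R * d%:~R + b%:~R * c%:~R) * w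
  + b%:~R * d%:~R * w ^+ 2); first by ring.
by rewrite w2; ring.
Qed.

Let OB (x y : algC) : O x -> O y -> O (x - y).
Proof. by move=> Ox Oy; rewrite -mulN1r; apply/OD/OM. Qed.

Let conj_int (m : int) : (m%:~R : algC)^* = m%:~R.
Proof. by rewrite conj_intr ?intr_int. Qed.

Let conj_coords (a b : int) :
  (a%:~R + b%:~R * w)^* = a%:~R + b%:~R * (1 - w).
Proof.
by rewrite rmorphD (rmorphM _ b%:~R) /= conj_w !conj_int.
Qed.

Let O_conj (x : algC) : O x -> O x^*.
Proof.
move=> /imag_quad_ringP[a [b ->]]; rewrite conj_coords.
by apply: OD => //; apply: OM => //; apply: OB.
Qed.

Let norm_coords (a b : int) :
  (a%:~R + b%:~R * w) * (a%:~R + b%:~R * w)^*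
  = (a ^+ 2 + a * b + 2%:Z * (k%:Z + 1) * b ^+ 2)%:~R.
Proof.
rewrite conj_coords !(rmorphXn, rmorphD, rmorphM) /= -!pmulrn.
transitivity (a%:~R ^+ 2 + a%:~R * b%:~R + b%:~R ^+ 2 * (w - w ^+ 2) : algC).
  by ring.
by rewrite w2; ring.
Qed.

Let O_Crat_int (x : algC) : O x -> x \in Crat -> exists m : int, x = m%:~R.
Proof. by case=> _ xA xQ; apply/intrP; exact: Cint_rat_Aint. Qed.

(** * Powers of a prime above 2 and their generators *)

Section PrimeAboveTwo.
Variable P : set algC.
Hypothesis P_prime : is_prime_ideal_above O 2 P.

Let P_ideal : is_ideal O P.
Proof. by case: P_prime => [[]]. Qed.

Let PO (x : algC) : P x -> O x.
Proof. by case: P_ideal => + _ _ _; apply. Qed.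

Let PD (x y : algC) : P x -> P y -> P (x + y).
Proof. by case: P_ideal => _ _ + _; apply. Qed.

Let PM (x y : algC) : O x -> P y -> P (x * y).
Proof. by case: P_ideal => _ _ _; apply. Qed.

Let P2 : P 2%:R. Proof. by case: P_prime. Qed.

Let PN1 : ~ P 1. Proof. by case: P_prime => [[]]. Qed.

Let P_even (m : int) : P m%:~R -> exists m', m = 2%:Z * m'.
Proof.
move=> Pm; have [m' [->|mE]] : exists m', m = 2%:Z * m' \/ m = 2%:Z * m' + 1.
- by exists (m %/ 2)%Z; lia.
- by exists m'.
case: PN1; have -> : 1 = m%:~R + (- m')%:~R * 2%:R :> algC.
  by rewrite mE !(rmorphD, rmorphM, rmorphN) /= -!pmulrn; ring.
by apply: PD => //; apply: PM.
Qed.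

Let P_w_or_conj : P w \/ P (1 - w).
Proof.
have [_ _ P_or] : is_prime_ideal O P by case: P_prime.
apply: P_or => //; first exact: OB.
have -> : w * (1 - w) = (k%:Z + 1)%:~R * 2%:R.
  transitivity (w - w ^+ 2); first by ring.
  by rewrite w2 rmorphD /= -pmulrn; ring.
exact: PM.
Qed.

(** Handles both primes above 2 at once: [th] is whichever of [w] and its conjugate lies in [P]. *)
Let P_generator : exists th, [/\ P th, th^* = 1 - th,
  th * (1 - th) = 2%:R * (k%:R + 1) &
  forall x, O x -> exists a b : int, x = a%:~R + b%:~R * th].
Proof.
have ww : w * (1 - w) = 2%:R * (k%:R + 1).
  transitivity (w - w ^+ 2); first by ring.
  by rewrite w2; ring.
case: P_w_or_conj => Pw; [exists w|exists (1 - w)]; split=> //.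
- by move=> x /imag_quad_ringP.
- by rewrite rmorphB rmorph1 /= conj_w.
- by rewrite -ww; ring.
move=> x /imag_quad_ringP[a [b ->]]; exists (a + b), (- b).
by rewrite rmorphD rmorphN /=; ring.
Qed.

(** The residue ring has two elements: a + b th is congruent to the integer a, and 2 lies in [P]. *)
Let P_or_compl (x : algC) : O x -> P x \/ P (1 - x).
Proof.
have [th [Pth _ _ gen]] := P_generator.
move=> /gen[a [b ->]].
have [a' [->|->]] : exists a', a = 2%:Z * a' \/ a = 2%:Z * a' + 1.
- by exists (a %/ 2)%Z; lia.
- left; rewrite mulrC rmorphM /=; apply: PD; exact: PM.
right; have -> : 1 - ((2%:Z * a' + 1)%:~R + b%:~R * th)
   = (- a')%:~R * 2%:R + (- b)%:~R * th :> algC.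
  by rewrite !(rmorphD, rmorphN, rmorphM) /= -!pmulrn; ring.
by apply: PD; exact: PM.
Qed.

(** [P] is spanned over Z by 2 and [th], and the products of these with their conjugates are 4, 2 (1
    - th), 2 th and th (1 - th) = 2 (k + 1). *)
Let mul_conj_P (x y : algC) :
  P x -> P y -> exists2 t, O t & x * y^* = 2%:R * t.
Proof.
have [th [Pth cth nth gen]] := P_generator.
have coords z : P z -> exists a b : int, z = 2%:R * a%:~R + b%:~R * th.
  move=> Pz; have [a [b zE]] := gen z (PO Pz).
  have /P_even[a' aE] : P a%:~R.
    have -> : a%:~R = z + (- b)%:~R * th by rewrite zE rmorphN /=; ring.
    by apply: PD => //; apply: PM.
  by exists a', b; rewrite zE aE rmorphM.
move=> /coords[a [b ->]] /coords[c [d ->]].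
exists (2%:R * a%:~R * c%:~R + a%:~R * d%:~R * (1 - th)
        + b%:~R * c%:~R * th + b%:~R * d%:~R * (k%:R + 1)).
  have Oth := PO Pth.
  have Ok : O (k%:R + 1) by have := O_int (k%:Z + 1); rewrite rmorphD.
  by do ?[by [] | exact: (O_int 2) | apply: OM | apply: OB | apply: OD].
rewrite rmorphD (rmorphM _ 2%:R) (rmorphM _ d%:~R) /= !conj_int conjC_nat cth.
transitivity (4%:R * a%:~R * c%:~R + 2%:R * a%:~R * d%:~R * (1 - th)
  + 2%:R * b%:~R * c%:~R * th + b%:~R * d%:~R * (th * (1 - th))); first by ring.
by rewrite nth; ring.
Qed.

Let mul_conj_exp (m : nat) (x y : algC) :
  ideal_exp O P m x -> ideal_exp O P m y ->
  exists2 t, O t & x * y^* = 2%:R ^+ m * t.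
Proof.
elim: m x y => [|m IHm] x y.
  by move=> Ox Oy; exists (x * y^*); rewrite ?mul1r //; apply/OM/O_conj.
case=> [n1 [x1 [x2 [Px ->]]]] [n2 [y1 [y2 [Py ->]]]].
have sumO n (F : 'I_n -> algC) : (forall i, exists2 t, O t & F i = 2%:R ^+ m.+1 * t) ->
    exists2 t, O t & \sum_(i < n) F i = 2%:R ^+ m.+1 * t.
  move=> FO; elim/big_ind: _ => [|_ _ [t Ot ->] [u Ou ->]|i _]; last exact: FO.
    by exists 0; rewrite // mulr0.
  by exists (t + u); [exact: OD|rewrite mulrDr].
rewrite mulr_suml; apply: (sumO) => i; rewrite rmorph_sum mulr_sumr.
apply: sumO => j; rewrite rmorphM /=.
have [[Px1 Ex2] [Py1 Ey2]] := (Px i, Py j).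
have [t Ot tE] := mul_conj_P Px1 Py1; have [u Ou uE] := IHm _ _ Ex2 Ey2.
exists (t * u); first exact: OM.
by rewrite mulrACA tE uE exprS mulrACA.
Qed.

Let exp_ideal (m : nat) : is_ideal O (ideal_exp O P m).
Proof. exact: is_ideal_exp. Qed.

(* The ideal P and the conjugate of d are comaximal when the latter is not in
   P, whence d lies in P ^ m; conversely P ^ m times the conjugate of d lies in
   2 ^ m O = d (conj d) O. *)
Let exp_principal (m : nat) (d : algC) :
    O d -> d * d^* = 2%:R ^+ m -> ~ P d^* ->
  same_ideal_class O (ideal_exp O P m) O.
Proof.
move=> Od dd Pd; have [_ _ eD eM] := exp_ideal m.
have d0 : d != 0.
  by apply: contra_eq_neq dd => ->; rewrite mul0r eq_sym expf_neq0 ?pnatr_eq0.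
have cd0 : d^* != 0 by rewrite fmorph_eq0.
have Ocd := O_conj Od.
have Pcd : P (1 - d^*) by have [] := P_or_compl Ocd.
have Ed : ideal_exp O P m d.
  have [u Ou uE] := one_sub_exprP O0 O1 OD OM m Ocd ON1.
  (* This is 1 = (1 - conj d)^m + u conj d multiplied by [d]. Both 1 - conj d and 2 lie in [P], so
     both terms lie in P^m. *)
  have -> : d = d * (1 - d^*) ^+ m + u * (2%:R ^+ m).
    by rewrite -dd; transitivity (d * ((1 - d^*) ^+ m + d^* * u)); [rewrite -uE|]; ring.
  by apply: eD; apply: eM => //; apply: ideal_exp_expr.
apply: (same_class_principal O1 Od d0) => z; split=> [Ez|[t Ot ->]].
  have [t Ot zt] := mul_conj_exp Ez Ed; exists t => //.
  by apply: (mulIf cd0); rewrite zt -dd; ring.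
by rewrite mulrC; apply: eM.
Qed.

(** A generator [c] satisfies c conj c = 2^m v with [v] in [O]; this [v] turns out to be a unit and
    a positive rational integer, hence 1. *)
Let principal_norm (m : nat) : (0 < m)%N ->
  same_ideal_class O (ideal_exp O P m) O ->
  exists c, [/\ O c, c * c^* = 2%:R ^+ m & ~ P c^*].
Proof.
move=> m0 /same_class_O_principal[c c0 Ec].
have [eO _ _ _] := exp_ideal m.
have Ecc : ideal_exp O P m c by apply/Ec; exists 1; rewrite ?mulr1.
have Oc : O c := eO _ Ecc.
have Ocd := O_conj Oc.
have cd0 : c^* != 0 by rewrite fmorph_eq0.
have Pcd : ~ P c^*.
  (* The element th^m is a multiple of [c], so its conjugate (1 - th)^m would lie in [P]; then so
     would 1 - th, and 1 = th + (1 - th). *)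
  move=> Pcd; have [th [Pth cth _ _]] := P_generator.
  have /Ec[t Ot tE] : ideal_exp O P m (th ^+ m) by apply: ideal_exp_expr.
  have : P ((th ^+ m)^*) by rewrite tE rmorphM mulrC; apply: PM => //; exact: O_conj.
  rewrite rmorphXn /= cth => P1.
  have [_ _ P_or] : is_prime_ideal O P by case: P_prime.
  suff : P (1 - th) by move=> /(PD Pth); rewrite subrKC.
  have O1th : O (1 - th) by rewrite -cth; apply/O_conj/PO.
  elim: (m) P1 => [/PN1//|n IHn]; rewrite exprS => /P_or[] //.
  by elim: (n) => [|j Oj]; rewrite ?expr0 // exprS; apply: OM.
exists c; split=> //.
have [v Ov vE] := mul_conj_exp Ecc Ecc.
(* 2 ^ m is a multiple of c, and of its conjugate, and these are comaximal. *)
have /Ec[t Ot tE] : ideal_exp O P m (2%:R ^+ m) by apply: ideal_exp_expr.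
have tE' : 2%:R ^+ m = c^* * t^* by rewrite -rmorphM -tE rmorphXn /= conjC_nat.
have P1cd : P (1 - c^*) by have [] := P_or_compl Ocd.
have /Ec[r Or rE] : ideal_exp O P m ((1 - c^*) ^+ m) by apply: ideal_exp_expr.
have [u Ou uE] := one_sub_exprP O0 O1 OD OM m Ocd ON1.
have two0 : 2%:R ^+ m != 0 :> algC by rewrite expf_neq0 ?pnatr_eq0.
(* Here 2^m = c t, and 1 = c r + u conj c. Multiplying the claim by 2^m replaces 2^m v by c conj c,
   and the two terms become 2^m c r and 2^m u conj c. *)
have vv : v * (t^* * r + t * u) = 1.
  apply: (mulfI two0); rewrite mulrA -vE mulr1.
  transitivity (c * (c^* * t^* * r + t * (c^* * u))); first by ring.
  by rewrite -tE' tE -uE rE; ring.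
have vQ : v \in Crat.
  have -> : v = c * c^* / 2%:R ^+ m by rewrite vE mulrC mulKf.
  have /imag_quad_ringP[a [b ->]] := Oc; rewrite norm_coords.
  by apply: rpred_div; rewrite ?rpredX ?rpred_nat ?rpred_int.
have v0 : v != 0 by apply: contra_eq_neq vv => ->; rewrite mul0r eq_sym oner_eq0.
have v'E : t^* * r + t * u = v^-1.
  by have /mulfI := v0; apply; rewrite vv divff.
have [n nE] := O_Crat_int Ov vQ.
have Ov' : O (t^* * r + t * u) by apply: OD; apply: OM => //; exact: O_conj.
have [|n' n'E] := O_Crat_int Ov'; first by rewrite v'E rpredV.
have nn : n * n' = 1.
  by apply: (@intr_inj algC); rewrite rmorphM /= -nE -n'E vv.
have v_gt0 : 0 < v.
  by rewrite -(pmulr_rgt0 _ (_ : 0 < 2%:R ^+ m)) ?exprn_gt0 // -vE mul_conjC_gt0.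
rewrite nE ltr0z in v_gt0.
have n'_gt0 : 0 < n' by rewrite -(pmulr_rgt0 _ v_gt0) nn.
have n1 : n = 1 by nia.
by rewrite vE nE n1 mulr1.
Qed.


(** By symmetry p divides A, say A = A' p. Cancelling p leaves coprime A' and B with product b^2, so
    both are squares. *)
Let coprime_factors (A B b : nat) :
    coprime A B -> odd A -> odd B -> (A * B = p * b ^ 2)%N ->
  exists al be : nat, [/\ odd al, odd be & (be ^ 2 + p * al ^ 2 = A + B)%N].
Proof.
wlog : A B / (p %| A)%N.
  move=> th cAB oA oB AB; have : (p %| A * B)%N by rewrite AB dvdn_mulr.
  rewrite Euclid_dvdM // => /orP[pA|pB]; first exact: th.
  by rewrite addnC; apply: th => //; rewrite 1?coprime_sym // mulnC.
move=> /dvdnP[A' ->] cAB; rewrite oddM => /andP[oA' _] oB.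
rewrite mulnAC [RHS]mulnC => /eqP; rewrite eqn_pmul2r ?prime_gt0 // => /eqP AB.
have cA'B : coprime A' B by apply: coprime_dvdl cAB; apply: dvdn_mulr.
have [al alE] := coprime_mul_eq_sqr cA'B AB.
have [be beE] : exists be, (B = be ^ 2)%N.
  by apply: (@coprime_mul_eq_sqr B A' b); rewrite 1?coprime_sym // mulnC.
exists al, be; split; last by rewrite -alE -beE addnC mulnC.
  by move: oA'; rewrite alE oddX.
by move: oB; rewrite beE oddX.
Qed.

(* Factor p b ^ 2 = (2 ^ (m + 1) - u) (2 ^ (m + 1) + u). *)
Let sum_sqr_descent (u b : nat) (m : nat) : odd u -> odd b ->
    (u ^ 2 + p * b ^ 2 = 2 ^ (2 * m.+1))%N ->
  exists al be : nat, [/\ odd al, odd be & (be ^ 2 + p * al ^ 2 = 2 ^ m.+2)%N].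
Proof.
move=> ou ob E; have {}E : (u ^ 2 + p * b ^ 2 = (2 ^ m.+1) ^ 2)%N.
  by rewrite E -expnM mulnC.
have oX : odd (2 ^ m.+1) = false by rewrite oddX.
have uX : (u < 2 ^ m.+1)%N.
  rewrite -(ltn_exp2r _ _ (ltn0Sn 1)) -E -addn1 leq_add2l.
  by rewrite muln_gt0 prime_gt0 // expn_gt0 odd_gt0.
have oA : odd (2 ^ m.+1 - u) by rewrite oddB ?oX ?ou // ltnW.
have oB : odd (2 ^ m.+1 + u) by rewrite oddD oX ou.
have sAB : (2 ^ m.+1 - u + (2 ^ m.+1 + u) = 2 ^ m.+2)%N.
  by rewrite [RHS]expnS; lia.
rewrite -sAB; apply: (@coprime_factors _ _ b) => //; last first.
  by rewrite -subn_sqr -E addKn.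
(* The factors have the gcd of the first one, which is odd, with their sum, a power of 2. *)
have : coprime (2 ^ m.+1 - u) (2 ^ m.+2) by rewrite coprimeXr // coprimen2.
by rewrite -sAB /coprime gcdnDl.
Qed.

Let half_exponent (m : nat) : (0 < m)%N ->
  same_ideal_class O (ideal_exp O P (2 * m)) O ->
  same_ideal_class O (ideal_exp O P m) O.
Proof.
move=> m0 /(principal_norm (_ : 0 < 2 * m)%N)[|c [Oc cc Pcc]]; first by lia.
have /imag_quad_ringP[a [b cE]] := Oc.
have abm : a ^+ 2 + a * b + 2%:Z * (k%:Z + 1) * b ^+ 2 = 2%:Z ^+ (2 * m).
  by apply: (@intr_inj algC); rewrite -norm_coords -cE cc rmorphXn.
have [e2 eE] : exists e, 2%:Z ^+ (2 * m) = 2%:Z * e.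
  by exists (2%:Z ^+ (2 * m).-1); rewrite -exprS prednK //; lia.
(* If [b] is even, the even norm forces [a] to be even too, and conj c lies in 2 O, hence in [P]. *)
have ob : odd `|b|.
  apply: contra_notT Pcc => eb.
  have [b' bE] : exists b', b = 2%:Z * b' by exists (b %/ 2)%Z; lia.
  have [a' aE] : exists a', a = 2%:Z * a'.
    exists (a %/ 2)%Z; move: abm; rewrite eE bE.
    have [a' [->|->]] : exists a', a = 2%:Z * a' \/ a = 2%:Z * a' + 1.
      by exists (a %/ 2)%Z; lia.
    - by lia.
    - by lia.
  rewrite cE conj_coords aE bE !rmorphM /=.
  have -> : 2%:~R * a'%:~R + 2%:~R * b'%:~R * (1 - w)
     = (a'%:~R + b'%:~R * (1 - w)) * 2%:R :> algC by ring.
  apply: PM => //; apply: OD => //; apply: OM => //; exact: OB.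
have [al [be [oal obe abE]]] : exists al be : nat,
    [/\ odd al, odd be & (be ^ 2 + p * al ^ 2 = 2 ^ (m.+2))%N].
  (* Four times the norm form is (2 a + b)^2 + p b^2. *)
  apply: (@sum_sqr_descent `|2%:Z * a + b| `|b|); rewrite //; first by lia.
  have pow : (2 ^ (2 * m.+1))%N%:Z = 4%:Z * 2%:Z ^+ (2 * m).
    by rewrite mulnS expnD PoszM; congr (_ * _); lia.
  apply/eqP; rewrite -eqz_nat pow -abm pE; apply/eqP.
  by rewrite -!abszX PoszD PoszM !gez0_abs ?sqr_ge0 //; lia.
(* With 2 t + al = be, four times the norm of t + al w is be^2 + p al^2 = 2^(m + 2). *)
have [t tE] : exists t : int, be%:Z = al%:Z + 2%:Z * t.
  by exists ((be%:Z - al%:Z) %/ 2)%Z; lia.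
pose d : algC := t%:~R + al%:Z%:~R * w.
have Od : O d by apply/imag_quad_ringP; exists t, al%:Z.
have dd : d * d^* = 2%:R ^+ m.
  have -> : 2%:R ^+ m = (2%:Z ^+ m)%:~R :> algC by rewrite rmorphXn.
  rewrite norm_coords; apply: congr1.
  apply: (mulfI (_ : 4%:Z != 0)) => //.
  have : 4%:Z * 2%:Z ^+ m = be%:Z ^+ 2 + p%:Z * al%:Z ^+ 2.
    by move: abE; rewrite !expnS; lia.
  by move=> ->; rewrite tE pE; lia.
(* Either [d] or its conjugate generates P^m. If both were in [P], so would be their difference al
   s, and then the odd integer p al^2. *)
have [Pd|/exp_principal] := pselect (P d^*); last by apply.
apply: (exp_principal (O_conj Od)); first by rewrite conjCK mulrC.
rewrite conjCK => Pd'.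
have Ps : P ((al%:Z)%:~R * s).
  have -> : (al%:Z)%:~R * s = d + (- 1) * d^*.
    by rewrite conj_coords /d sE; ring.
  by apply: PD => //; apply: PM.
have /P_even[x] : P ((al%:Z ^+ 2 * p%:Z)%:~R).
  have -> : (al%:Z ^+ 2 * p%:Z)%:~R = - (al%:Z)%:~R * s * ((al%:Z)%:~R * s).
    rewrite rmorphM rmorphXn /= -[p%:~R]opprK -[- p%:~R]s2; ring.
  apply: PM => //; rewrite mulNr -mulN1r; apply: OM => //; apply: OM => //.
  by rewrite sE; apply: OB => //; apply: OM => //; exact: (O_int 2).
have [y ->] : exists y, al = (2 * y + 1)%N by exists (al %/ 2)%N; lia.
by rewrite pE; lia.
Qed.

(** A generator would have norm 2, so (2 a + b)^2 + p b^2 = 8. As p is at least 15, b = 0 and a^2 =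
    2, which is impossible. *)
Let order_gt1 : (0 < k)%N -> ~ same_ideal_class O (ideal_exp O P 1) O.
Proof.
move=> k0 /(principal_norm (ltn0Sn 0))[c [/imag_quad_ringP[a [b ->]]]].
rewrite norm_coords => cc _.
have : a ^+ 2 + a * b + 2%:Z * (k%:Z + 1) * b ^+ 2 = 2%:Z.
  by apply: (@intr_inj algC); rewrite cc expr1.
have [-> aa|b0 ab] := eqVneq b 0.
  have {}aa : a ^+ 2 = 2%:Z by move: aa; rewrite mulr0 expr0n /= mulr0 !addr0.
  have [a2|a2] : `|a| <= 1 \/ 2 <= `|a| by lia.
    by nia.
  by nia.
have bb : 1 <= b ^+ 2 by nia.
have : (2%:Z * a + b) ^+ 2 + (8%:Z * k%:Z + 7%:Z) * b ^+ 2 = 8%:Z.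
  by rewrite -[RHS]/(4%:Z * 2%:Z) -[in RHS]ab; ring.
by have := sqr_ge0 (2%:Z * a + b); nia.
Qed.

Lemma ideal_class_order_odd (L : nat) :
  (0 < k)%N -> is_ideal_class_order O P L -> odd L /\ (2 < L)%N.
Proof.
move=> k0 [L0 LO Lmin].
have oL : odd L.
  apply/negPn/negP => eL; have LE : L = (2 * (L %/ 2))%N by lia.
  apply: (Lmin (L %/ 2)%N); first by lia.
  by apply: half_exponent; [lia|rewrite -LE].
split=> //; have [//|L2] := ltnP 2 L.
have L1 : L = 1%N by lia.
by rewrite L1 in LO; case: (order_gt1 k0 LO).
Qed.

End PrimeAboveTwo.
End ImaginaryQuadraticRing.

Local Close Scope ring_scope.

(** * The diameter of the graph *)

Lemma has_walkP (V : finType) (e : rel V) (x y : V) (k : nat) :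
  reflect (exists2 s : seq V, size s = k & path e x s /\ last x s = y)
          (has_walk e x y k).
Proof.
apply: (iffP existsP) => [[s /andP[es /eqP ls]]|[s sz [es ls]]].
  by exists s; rewrite ?size_tuple.
have sz' : size s == k by apply/eqP.
by exists (Tuple sz'); rewrite /= es ls eqxx.
Qed.

Lemma has_walk0 (V : finType) (e : rel V) (x : V) : has_walk e x x 0.
Proof. by apply/has_walkP; exists [::]. Qed.

Lemma has_walk1 (V : finType) (e : rel V) (x y : V) : e x y -> has_walk e x y 1.
Proof. by move=> exy; apply/has_walkP; exists [:: y] => //=; rewrite exy. Qed.

Lemma has_walk_trans (V : finType) (e : rel V) (x y z : V) (j k : nat) :
  has_walk e x y j -> has_walk e y z k -> has_walk e x z (j + k).
Proof.
move=> /has_walkP[s <- [es ls]] /has_walkP[t <- [et lt]].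
apply/has_walkP; exists (s ++ t); first by rewrite size_cat.
by rewrite cat_path last_cat es ls.
Qed.

Lemma has_walk_sym (V : finType) (e : rel V) (x y : V) (k : nat) :
  symmetric e -> has_walk e x y k -> has_walk e y x k.
Proof.
move=> se /has_walkP[s <- []]; elim: s x => [|z s IHs] x /=.
  by move=> _ ->; exact: has_walk0.
move=> /andP[exz es] ls; rewrite -addn1.
by apply: has_walk_trans (IHs _ es ls) (has_walk1 _); rewrite se.
Qed.

Lemma graph_dist_le (V : finType) (e : rel V) (x y : V) (k : nat) :
  k < #|V| -> has_walk e x y k -> graph_dist e x y <= k.
Proof.
move=> kV w; rewrite leqNgt; apply/negP => /(before_find 0).
by rewrite nth_iota // add0n w.
Qed.

(** Each edge raises [phi] by at most one. The bound involving [#|V|] covers the default value of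
    the distance when no walk exists. *)
Lemma graph_dist_ge (V : finType) (e : rel V) (x y : V) (phi : V -> nat) :
    (forall u v, e u v -> phi v <= (phi u).+1) -> phi y < phi x + #|V| ->
  phi y <= phi x + graph_dist e x y.
Proof.
move=> lip ltV; rewrite /graph_dist; set d := find _ _.
have [w|nw] := boolP (has (has_walk e x y) (iota 0 #|V|)); last first.
  by rewrite /d hasNfind // size_iota ltnW.
have dV : d < #|V| by rewrite -(size_iota 0 #|V|) -has_find.
have := nth_find 0 w; rewrite -/d nth_iota // add0n.
move=> /has_walkP[s <- []]; elim: s (x) => [|z s IHs] u /=.
  by move=> _ <-; rewrite addn0.
move=> /andP[/lip euz es] ls; rewrite addnS -addSn.
by apply: leq_trans (IHs z es ls) _; rewrite leq_add2r.
Qed.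

(** * The stacked graph: adjacency, short walks and the diameter *)

Lemma stacked_adjP (L u v : nat) :
  reflect
    ((exists2 i, i < L & (u, v) = (2 * i, 2 * i + 1) \/ (v, u) = (2 * i, 2 * i + 1))
     \/ (exists2 i, i < L - 1 & (u, v) = (2 * i + 1, 2 * i + 3)
                             \/ (v, u) = (2 * i + 1, 2 * i + 3))
     \/ ((u, v) = (2 * L - 1, 1) \/ (v, u) = (2 * L - 1, 1)))
    (stacked_adj L u v).
Proof.
rewrite /stacked_adj /stacked_edges !mem_cat !inE.
apply: (iffP idP).
  case/orP=> /or3P[/mapP[i]|/mapP[i]|/eqP E].
  - by rewrite mem_iota => ? ?; left; exists i; [lia|left].
  - by rewrite mem_iota => ? ?; right; left; exists i; [lia|left].
  - by right; right; left.
  - by rewrite mem_iota => ? ?; left; exists i; [lia|right].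
  - by rewrite mem_iota => ? ?; right; left; exists i; [lia|right].
  - by right; right; right.
have m0 i n : i < n -> i \in iota 0 n by rewrite mem_iota.
case=> [[i /m0 iL [E|E]]|[[i /m0 iL [E|E]]|[E|E]]]; rewrite E ?eqxx ?orbT //.
- by rewrite (map_f (fun i => (2 * i, 2 * i + 1))).
- by rewrite (map_f (fun i => (2 * i, 2 * i + 1))) ?orbT.
- by rewrite (map_f (fun i => (2 * i + 1, 2 * i + 3))) ?orbT.
- by rewrite (map_f (fun i => (2 * i + 1, 2 * i + 3))) ?orbT.
Qed.

Lemma stacked_adj_sym (L : nat) : symmetric (stacked_adj L).
Proof. by move=> u v; rewrite /stacked_adj orbC. Qed.

Section StackedWalks.
Variables (L : nat) (V : finType) (e : rel V) (g : nat -> V).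
Hypothesis eg : forall a b, a < 2 * L -> b < 2 * L -> e (g a) (g b) = stacked_adj L a b.
Hypothesis e_sym : symmetric e.

Lemma cycle_walk (i j : nat) :
  i <= j -> j < L -> has_walk e (g (2 * i + 1)) (g (2 * j + 1)) (j - i).
Proof.
move=> ij jL; rewrite -(subnKC ij); move: (j - i) (subnKC ij) => d dE.
have: i + d < L by lia.
rewrite addKn; elim: d {dE} => [|d IHd] idL.
  by rewrite addn0; exact: has_walk0.
rewrite -[d.+1]addn1; apply: has_walk_trans (IHd _) (has_walk1 _); first lia.
rewrite eg; [|lia..].
apply/stacked_adjP; right; left; exists (i + d); first lia.
by left; congr pair; lia.
Qed.

(** Down from 2 i + 1 to 1 in i steps, across the closing edge to 2 L - 1, then down to 2 j + 1 in L
    - 1 - j steps. *)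
Lemma cycle_walk_around (i j : nat) :
  i <= j -> j < L -> has_walk e (g (2 * i + 1)) (g (2 * j + 1)) (L - (j - i)).
Proof.
move=> ij jL; have -> : L - (j - i) = i - 0 + (1 + (L.-1 - j)) by lia.
apply: has_walk_trans (has_walk_sym e_sym (cycle_walk (leq0n i) _)) _; first lia.
apply: has_walk_trans (has_walk1 _)
  (has_walk_sym e_sym (cycle_walk (j := L.-1) _ _)); [|lia|lia].
rewrite eg; [|lia..]; apply/stacked_adjP; right; right; right.
by congr pair; lia.
Qed.

Lemma pendant_walk (a : nat) : a < 2 * L ->
  exists2 d, d <= 1 & has_walk e (g a) (g (2 * (a %/ 2) + 1)) d.
Proof.
move=> aL; have [/eqP a0|a1] := boolP (a %% 2 == 0).
  exists 1 => //; apply: has_walk1; rewrite eg; [|lia..].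
  by apply/stacked_adjP; left; exists (a %/ 2); [lia|left; congr pair; lia].
have aE : 2 * (a %/ 2) + 1 = a by lia.
by exists 0; rewrite // aE; exact: has_walk0.
Qed.

(** The shorter arc of the cycle has at most L / 2 edges, and each end adds at most one pendant
    edge. *)
Lemma short_walk (a b : nat) : a < 2 * L -> b < 2 * L ->
  exists2 d, d <= L %/ 2 + 2 & has_walk e (g a) (g b) d.
Proof.
wlog ab : a b / a %/ 2 <= b %/ 2.
  move=> th aL bL; have [ab|/ltnW ba] := leqP (a %/ 2) (b %/ 2); first exact: th.
  by have [d dL w] := th _ _ ba bL aL; exists d => //; exact: has_walk_sym.
move=> aL bL; have [da da1 wa] := pendant_walk aL.
have [db db1 /(has_walk_sym e_sym) wb] := pendant_walk bL.
have bL' : b %/ 2 < L by lia.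
have [le|gt] := leqP (b %/ 2 - a %/ 2) (L %/ 2).
  exists (da + ((b %/ 2 - a %/ 2) + db)); first lia.
  exact: has_walk_trans wa (has_walk_trans (cycle_walk ab bL') wb).
exists (da + ((L - (b %/ 2 - a %/ 2)) + db)); first lia.
exact: has_walk_trans wa (has_walk_trans (cycle_walk_around ab bL') wb).
Qed.

End StackedWalks.

(* The distance from the pendant vertex 0, so that it is 1-Lipschitz along
   edges. *)
Definition stacked_height (L a : nat) : nat :=
  if a == 0 then 0
  else minn (a %/ 2) (L - a %/ 2) + (2 - a %% 2).

Lemma stacked_height_lip (L u v : nat) :
  1 < L -> stacked_adj L u v -> stacked_height L v <= (stacked_height L u).+1.
Proof.
rewrite /stacked_height => L1 /stacked_adjP.
case=> [[i iL [[-> ->]|[-> ->]]]|[[i iL [[-> ->]|[-> ->]]]|[[-> ->]|[-> ->]]]].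
all: do 2! case: eqP => ?; lia.
Qed.

Lemma stacked_diam (L : nat) (V : finType) (e : rel V) :
  2 < L -> is_stacked_component L e -> diam e = L %/ 2 + 2.
Proof.
move=> L2 [f [g fK gK] ef].
have V2L : #|V| = 2 * L.
  by rewrite -[RHS]card_ord; apply: bij_eq_card (Bijective fK gK).
have L_gt0 : 0 < 2 * L by lia.
(* The inverse labelling extended to all of [nat]; labels out of range go to the vertex labelled
   0. *)
pose h a := g (insubd (Ordinal L_gt0) a).
have fh a : a < 2 * L -> f (h a) = a :> nat.
  by move=> aL; rewrite /h gK val_insubd aL.
have hf v : h (f v) = v by rewrite /h valKd fK.
have e_sym : symmetric e by move=> u v; rewrite !ef stacked_adj_sym.
have eh a b : a < 2 * L -> b < 2 * L -> e (h a) (h b) = stacked_adj L a b.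
  by move=> aL bL; rewrite ef !fh.
apply/eqP; rewrite eqn_leq; apply/andP; split.
  apply/bigmax_leqP => x _; apply/bigmax_leqP => y _.
  have [d dL w] := short_walk eh e_sym (ltn_ord (f x)) (ltn_ord (f y)).
  rewrite !hf in w; have dV : d < #|V| by rewrite V2L; lia.
  exact: leq_trans (graph_dist_le dV w) dL.
(* The bound is attained between the pendants 0 and 2 (L / 2), whose feet are L / 2 apart on the
   cycle. *)
have h0 : stacked_height L (f (h 0)) = 0 by rewrite fh //; lia.
have h1 : stacked_height L (f (h (2 * (L %/ 2)))) = L %/ 2 + 2.
  by rewrite fh /stacked_height; [case: eqP => ?; lia|lia].
have lip u v : e u v -> stacked_height L (f v) <= (stacked_height L (f u)).+1.
  by rewrite ef; apply: stacked_height_lip; lia.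
have := @graph_dist_ge _ e (h 0) (h (2 * (L %/ 2))) _ lip.
rewrite h0 h1 V2L => /(_ ltac:(lia)) /leq_trans; apply.
apply: leq_trans (leq_bigmax (h 0)).
exact: (leq_bigmax (F := fun y => graph_dist e (h 0) y)).
Qed.

Theorem theorem32 (p : nat) (hp : prime p)
    (hpmod : p = 71 %[mod 120] \/ p = 119 %[mod 120])
    (P : set algC) (hP : is_prime_ideal_above (imag_quad_ring p) 2 P)
    (L : nat) (hL : is_ideal_class_order (imag_quad_ring p) P L)
    (V : finType) (e : rel V) (hV : is_stacked_component L e) :
  ((diam e)%:R = 1 / 2%:R * (L%:R + 3%:R) :> rat)%R.
Proof.
(* Both 71 and 119 are 7 modulo 8, and p is at least 71, so that k = p / 8 is positive. *)
have pE : p = 8 * (p %/ 8) + 7 by lia.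
have k0 : 0 < p %/ 8 by lia.
have [oL L2] := ideal_class_order_odd hp pE hP k0 hL.
have LE : L = 2 * (L %/ 2) + 1 by lia.
rewrite (stacked_diam L2 hV) [in RHS]LE !(natrM, natrD).
by field.
Qed.
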